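(* Let $\vartheta$ be a primitive random substitution of constant length over a finite alphabet $\mathcal{A}$. Then, for all $a\in\mathcal{A}$, the inflation word entropy $h_a=\lim_{m\to\infty}\frac{1}{|\vartheta^m(a)|}\log(\#\vartheta^m(a))$ exists and $h_a=h_{\mathrm{top}}(X_\vartheta)$.
   Context: Let $\mathcal{A}$ be a finite alphabet, $\mathcal{A}^+$ the set of non-empty finite words over $\mathcal{A}$. A random substitution over $\mathcal{A}$ is a map $\vartheta$ assigning to each letter $a\in\mathcal{A}$ a non-empty finite set $\vartheta(a)\subset\mathcal{A}^+$ of realisations (together with a choice of strictly positive probabilities on each $\vartheta(a)$, which plays no role here and is ignored). It is of constant length if there is an integer $\ell\ge 2$ such that $|v|=\ell$ for all $a\in\mathcal{A}$ and $v\in\vartheta(a)$. For a word $u=u_1\cdots u_n$, $\vartheta(u)=\{w_1\cdots w_n : w_i\in\vartheta(u_i)\}$; powers are defined by $\vartheta^1=\vartheta$ and $\vartheta^k(a)=\bigcup_{v\in\vartheta^{k-1}(a)}\vartheta(v)$. A word is $\vartheta$-legal if it is a (contiguous) subword of some word in $\vartheta^k(a)$ for some $k\in\mathbb{N}$, $a\in\mathcal{A}$; $\mathcal{L}_\vartheta$ is the set of legal words. The subshift of $\vartheta$ is $X_\vartheta=\{w\in\mathcal{A}^{\mathbb{Z}} : \text{every finite subword of } w \text{ lies in } \mathcal{L}_\vartheta\}$ with the left shift. $\vartheta$ is primitive if there is $k\in\mathbb{N}$ such that for all $a,b\in\mathcal{A}$ the letter $a$ occurs in at least one realisation in $\vartheta^k(b)$;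 by convention, the definition of primitivity is restricted to random substitutions with $X_\vartheta\neq\varnothing$. $|\vartheta^m(a)|$ denotes the common length of all realisations of $\vartheta^m(a)$ (equal to $\ell^m$ for constant length $\ell$), and $\#\vartheta^m(a)$ is the cardinality of the set $\vartheta^m(a)$. For a non-empty subshift $X$, $p_X(n)$ is the number of distinct words of length $n$ occurring in elements of $X$, and $h_{\mathrm{top}}(X)=\lim_{n\to\infty}\frac1n\log p_X(n)$. *)

(* Defs.v *)
From mathcomp Require Import all_boot all_order all_algebra finmap.
From mathcomp Require Import all_classical all_reals all_analysis.

Set Implicit Arguments.
Unset Strict Implicit.
Unset Printing Implicit Defensive.

Import Order.TTheory GRing.Theory Num.Theory.
Import numFieldNormedType.Exports.

Local Open Scope classical_set_scope.
Local Open Scope fset_scope.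
Local Open Scope ring_scope.

(** The probabilities attached to the realisations are omitted: none of the
    notions below depends on them. *)
Record random_substitution (A : finType) := RandomSubstitution {
  realisations :> A -> {fset seq A};
  realisations_neq0 : forall a, realisations a != fset0;
  realisations_nonempty : forall a v, v \in realisations a -> v != [::]
}.

Section RandomSubstitution.
Context {A : finType}.
Implicit Types (theta : random_substitution A) (X : set (int -> A)).

Definition subst_word theta (u : seq A) : {fset seq A} :=
  foldr (fun b S => [fset v ++ w | v in theta b, w in S]) [fset [::]] u.

Definition subst_set theta (S : {fset seq A}) : {fset seq A} :=
  \bigcup_(v <- S) subst_word theta v.

(** theta^0(a) = {a} serves only as base case: powers are meant for k > 0, as
    in [legal] and [primitive], and [subst_pow1] checks theta^1 = theta. *)
Definition subst_pow theta (k : nat) (a : A) : {fset seq A} :=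
  iter k (subst_set theta) [fset [:: a]].

Definition constant_length theta : Prop :=
  exists l : nat, (2 <= l)%N /\ forall a v, v \in theta a -> size v = l.

Definition legal theta : set (seq A) :=
  [set u | exists k a v,
    [/\ (0 < k)%N, v \in subst_pow theta k a & infix u v]].

Definition window (x : int -> A) (i : int) (n : nat) : seq A :=
  mkseq (fun j => x (i + j%:Z)) n.

Definition subshift theta : set (int -> A) :=
  [set x | forall i n, legal theta (window x i n)].

(** X_theta is required to be non-empty, as usual for primitivity. *)
Definition primitive theta : Prop :=
  (exists k : nat, (0 < k)%N /\
     forall a b, exists v, v \in subst_pow theta k b /\ a \in v) /\
  subshift theta !=set0.

Definition complexity X (n : nat) : nat :=
  #|[set w : n.-tuple A | `[< exists x i, X x /\ window x i n = w >]]%SET|.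

Definition topological_entropy (R : realType) X : R :=
  limn (fun n : nat => n%:R^-1 * ln (complexity X n)%:R : R).

(** The common length |theta^m(a)|, read off an arbitrary realisation; for
    constant length it does not depend on the choice, see
    [inflation_lengthE]. *)
Definition inflation_length theta (m : nat) (a : A) : nat :=
  size (head [::] (enum_fset (subst_pow theta m a))).

Definition inflation_entropy_seq (R : realType) theta (a : A) (m : nat) : R :=
  (inflation_length theta m a)%:R^-1 * ln (#|` subst_pow theta m a|)%:R.

Definition inflation_entropy (R : realType) theta (a : A) : R :=
  limn (inflation_entropy_seq R theta a).

Lemma subst_setP theta (S : {fset seq A}) w :
  reflect (exists2 v, v \in S & w \in subst_word theta v)
          (w \in subst_set theta S).
Proof.
apply: (iffP (bigfcupP _ _ _ _)) => [[v /andP[vS _] wv]|[v vS wv]]; exists v => //.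
by rewrite vS.
Qed.

Lemma subst_pow1 theta a : subst_pow theta 1 a = theta a.
Proof.
apply/fsetP => w; apply/subst_setP/idP => [[v]|wa].
  by rewrite inE => /eqP-> /imfset2P[u ua [t]];
    rewrite inE => /eqP-> ->; rewrite cats0.
exists [:: a]; first by rewrite inE.
by apply/imfset2P; exists w => //; exists [::]; rewrite ?inE ?cats0.
Qed.

Lemma subst_word_neq0 theta u : subst_word theta u != fset0.
Proof.
elim: u => [|b u /fset0Pn[w wu]] /=; apply/fset0Pn.
  by exists [::]; rewrite inE.
have /fset0Pn[v vb] := realisations_neq0 theta b.
by exists (v ++ w); apply/imfset2P; exists v => //; exists w.
Qed.

Lemma subst_pow_neq0 theta m a : subst_pow theta m a != fset0.
Proof.
elim: m => [|m /fset0Pn[v vm]]; apply/fset0Pn; first by exists [:: a]; rewrite inE.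
have /fset0Pn[w wv] := subst_word_neq0 theta v.
by exists w; apply/subst_setP; exists v.
Qed.

Lemma size_subst_pow theta l m a v :
  (forall b w, w \in theta b -> size w = l) ->
  v \in subst_pow theta m a -> size v = (l ^ m)%N.
Proof.
move=> thl; elim: m v => [|m IHm] w; first by rewrite inE => /eqP->.
case/subst_setP => v /IHm vl wv.
suff -> : size w = (size v * l)%N by rewrite vl expnSr.
elim: v w wv {vl} => [|b v IHv] w /=; first by rewrite inE => /eqP->.
by case/imfset2P => s /thl sl [t /IHv tl ->]; rewrite size_cat sl tl mulSn.
Qed.

Lemma inflation_lengthE theta l m a :
  (forall b w, w \in theta b -> size w = l) ->
  (forall v, v \in subst_pow theta m a ->
     size v = inflation_length theta m a) /\
  inflation_length theta m a = (l ^ m)%N.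
Proof.
move=> thl; have lE : inflation_length theta m a = (l ^ m)%N.
  apply: (size_subst_pow (a := a) thl).
  have /fset0Pn[v vm] := subst_pow_neq0 theta m a.
  have {}vm : v \in enum_fset (subst_pow theta m a) by [].
  rewrite -[_ \in subst_pow _ _ _]/(_ \in enum_fset _).
  by case: (enum_fset _) vm => // ? ? _; exact: mem_head.
by split=> // v vm; rewrite lE (size_subst_pow thl vm).
Qed.

End RandomSubstitution.

(* Main.v *)
(** Write L_m(b) = l^-m ln #theta^m(b), and let p(n) be the number of legal words
    of length n.  By primitivity every legal word extends to a point of the
    subshift, so p is its complexity; it is submultiplicative, whence
    ln p(n) / n tends to its infimum h (Fekete).
    Inflation words are legal, so L_m(b) <= ln p(l^m) / l^m.  Conversely a legal
    word of length r l^m sits inside a concatenation of r + 1 inflation words of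
    level m, which yields h <= max_b L_m(b) + l^-m ln #A as r tends to infinity.
    To pass from the maximum to every letter, let K be an exponent of primitivity
    and q = l^-K: some word of theta^K(a) contains the maximising letter, and
    concatenations of words of equal length are uniquely decodable, so
    L_(m+K)(a) >= (1 - q) min_b L_m(b) + q max_b L_m(b).  Hence the gap
    h - min_b L_m(b) contracts to 0. *)
Require Import Defs.
From mathcomp Require Import all_boot all_order all_algebra finmap.
From mathcomp Require Import all_classical all_reals all_analysis.
From mathcomp Require Import zify ring lra.
Import Order.TTheory GRing.Theory Num.Theory.
Import numFieldNormedType.Exports.

Set Implicit Arguments.
Unset Strict Implicit.
Unset Printing Implicit Defensive.

Local Open Scope classical_set_scope.

(** * Cardinality of sets of concatenations *)

Section FsetCard.
Local Open Scope fset_scope.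

Lemma card_fset_cat_le (T : choiceType) (S1 S2 : {fset seq T}) :
  (#|` [fset v ++ w | v in S1, w in S2]| <= #|` S1| * #|` S2|)%N.
Proof.
rewrite -(size_allpairs cat); apply: uniq_leq_size (fset_uniq _) _ => x.
case/imfset2P => v vS1 [w wS2 ->].
by apply/allpairsP; exists (v, w).
Qed.

(** The common length of the words of [S1] fixes where to cut [v ++ w], so concatenation is
    injective on pairs. *)
Lemma card_fset_cat (T : choiceType) (S1 S2 : {fset seq T}) (l : nat) :
  (forall v, v \in S1 -> size v = l) ->
  #|` [fset v ++ w | v in S1, w in S2]| = (#|` S1| * #|` S2|)%N.
Proof.
move=> S1l; apply/eqP; rewrite eqn_leq card_fset_cat_le /=.
rewrite -(size_allpairs cat); apply: uniq_leq_size => [|x].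
  apply: allpairs_uniq (fset_uniq _) (fset_uniq _) _ => -[v w] [v' w'].
  move=> /allpairsP[[? ?] /= [/S1l vl _ [-> ->]]].
  move=> /allpairsP[[? ?] /= [/S1l vl' _ [-> ->]]].
  by move=> /eqP; rewrite /= eqseq_cat ?vl ?vl' // => /andP[/eqP-> /eqP->].
case/allpairsP => -[v w] /= [vS wS ->].
by apply/imfset2P; exists v => //; exists w.
Qed.

Lemma card_bigfcup_le (I : Type) (T : choiceType) (s : seq I)
    (F : I -> {fset T}) :
  (#|` \bigcup_(i <- s) F i| <= \sum_(i <- s) #|` F i|)%N.
Proof.
elim/big_rec2: _ => [|i n U _ leUn]; first by rewrite cardfs0.
by rewrite (leq_trans (leq_card_fsetU _ _).1) ?leq_add2l.
Qed.

End FsetCard.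

(** * Powers of a random substitution *)

Section SubstitutionPowers.
Local Open Scope fset_scope.
Context {A : finType}.
Implicit Types (theta sigma : random_substitution A) (u v w : seq A).

Lemma subst_word_consP theta b u w :
  reflect (exists v1 v2, [/\ v1 \in theta b, v2 \in subst_word theta u &
             w = v1 ++ v2])
          (w \in subst_word theta (b :: u)).
Proof.
apply: (iffP idP) => /= [/imfset2P[v1 ? [v2 ? ->]]|[v1 [v2 [? ? ->]]]].
  by exists v1, v2.
by apply/imfset2P; exists v1 => //; exists v2.
Qed.

Lemma subst_word_catP theta u v w :
  reflect (exists w1 w2, [/\ w1 \in subst_word theta u,
             w2 \in subst_word theta v & w = w1 ++ w2])
          (w \in subst_word theta (u ++ v)).
Proof.
apply: (iffP idP) => [|[w1 [w2 [+ + ->]]]].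
  elim: u w => [|b u IHu] w.
    by move=> wv; exists [::], w; rewrite inE.
  rewrite cat_cons => /subst_word_consP[x [y [xb /IHu[w1 [w2 [h1 h2 ->]]] ->]]].
  by exists (x ++ w1), w2; rewrite catA; split=> //; apply/subst_word_consP; exists x, w1.
elim: u w1 => [|b u IHu] w1; first by rewrite inE => /eqP->.
move=> /subst_word_consP[x [y [xb yu ->]]] w2v.
by rewrite cat_cons -catA; apply/subst_word_consP; exists x, (y ++ w2); rewrite IHu.
Qed.

Lemma subst_word_size_ge theta u w :
  w \in subst_word theta u -> (size u <= size w)%N.
Proof.
elim: u w => [//|b u IHu] w /subst_word_consP[x [y [/realisations_nonempty xn0 /IHu yu ->]]].
by rewrite size_cat; case: x xn0 => //= c x _; lia.
Qed.

Lemma subst_pow_nonempty theta m a v :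
  v \in subst_pow theta m a -> v != [::].
Proof.
rewrite -size_eq0 -lt0n.
elim: m v => [|m IHm] w; first by rewrite inE => /eqP->.
by case/subst_setP => v /IHm v0 /subst_word_size_ge; exact: leq_trans.
Qed.

(** Bundling theta^m as a random substitution makes [subst_word] and its lemmas available for it. *)
Definition rs_pow theta m : random_substitution A :=
  RandomSubstitution (@subst_pow_neq0 _ theta m) (@subst_pow_nonempty theta m).

Lemma subst_word_powSP theta m v w :
  reflect (exists2 u, u \in subst_word (rs_pow theta m) v & w \in subst_word theta u)
          (w \in subst_word (rs_pow theta m.+1) v).
Proof.
apply: (iffP idP) => [|[u + wu]].
  elim: v w => [|b v IHv] w.
    by rewrite inE => /eqP->; exists [::]; rewrite inE.
  case/subst_word_consP => x [y [/subst_setP[x' x'b xx'] /IHv[y' y'v yy'] ->]].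
  exists (x' ++ y'); first by apply/subst_word_consP; exists x', y'.
  by apply/subst_word_catP; exists x, y.
elim: v u w wu => [|b v IHv] u w wu.
  by rewrite inE => /eqP uE; move: wu; rewrite uE.
case/subst_word_consP => x [y [xb yv uE]].
move: wu; rewrite uE => /subst_word_catP[w1 [w2 [w1x w2y ->]]].
apply/subst_word_consP; exists w1, w2; split => //; last exact: IHv yv.
by apply/subst_setP; exists x.
Qed.

(** [subst_pow] applies theta one step at a time; splitting off theta^m at once exhibits a word of
    level m + k as a concatenation of inflation words of level m. *)
Lemma subst_powDP theta m k a w :
  reflect (exists2 v, v \in subst_pow theta k a &
             w \in subst_word (rs_pow theta m) v)
          (w \in subst_pow theta (m + k) a).
Proof.
elim: m w => [|m IHm] w.
  suff sw0 v : subst_word (rs_pow theta 0) v = [fset v].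
    apply: (iffP idP) => [wk|[v vk]]; first by exists w; rewrite ?sw0 ?inE.
    by rewrite sw0 inE => /eqP->.
  elim: v => //= b v ->; apply/fsetP => x; rewrite inE.
  apply/imfset2P/eqP => [[y]|->].
    by rewrite inE => /eqP-> [z]; rewrite inE => /eqP-> ->.
  by exists [:: b]; rewrite ?inE //; exists v; rewrite ?inE.
apply: (iffP (subst_setP _ _ _)) => [[x /IHm[v vk xv] wx]|[v vk]].
  by exists v => //; apply/subst_word_powSP; exists x.
by case/subst_word_powSP => x xv wx; exists x => //; apply/IHm; exists v.
Qed.

Lemma card_subst_word theta l u :
  (forall b v, v \in theta b -> size v = l) ->
  #|` subst_word theta u| = (\prod_(b <- u) #|` theta b|)%N.
Proof.
move=> thl; elim: u => [|b u IHu] /=; first by rewrite big_nil cardfs1.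
by rewrite big_cons -IHu; apply: card_fset_cat (thl b).
Qed.

Lemma subst_word_flatten theta u w : w \in subst_word theta u ->
  exists2 ss, (forall s, s \in ss -> exists b, s \in theta b) & w = flatten ss.
Proof.
elim: u w => [|b u IHu] w; first by rewrite inE => /eqP->; exists [::].
case/subst_word_consP => x [y [xb /IHu[ss uss ->] ->]].
exists (x :: ss) => // s; rewrite inE => /orP[/eqP->|/uss//].
by exists b.
Qed.

(** The distinguished [a] is realised by [v], the other letters arbitrarily; realisations are
    non-empty, so neither side gets shorter. *)
Lemma subst_pow_surround theta k j a b v x1 x2 :
  v \in subst_pow theta k a -> x1 ++ a :: x2 \in subst_pow theta j b ->
  exists w1 w2, [/\ w1 ++ v ++ w2 \in subst_pow theta (k + j) b,
    (size x1 <= size w1)%N & (size x2 <= size w2)%N].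
Proof.
move=> va xb.
have /fset0Pn[w1 w1x] := subst_word_neq0 (rs_pow theta k) x1.
have /fset0Pn[w2 w2x] := subst_word_neq0 (rs_pow theta k) x2.
exists w1, w2; split.
- apply/subst_powDP; exists (x1 ++ a :: x2) => //.
  apply/subst_word_catP; exists w1, (v ++ w2); split=> //.
  by apply/subst_word_consP; exists v, w2.
- exact: subst_word_size_ge w1x.
- exact: subst_word_size_ge w2x.
Qed.

(** * Legal words and their extension to points of the subshift *)

Lemma legal_infix theta u v : infix u v -> legal theta v -> legal theta u.
Proof.
move=> uv [k [a [w [k0 wk vw]]]]; exists k, a, w; split => //.
exact: infix_trans vw.
Qed.

(** Primitivity places the letter [a] whose inflation contains [u] in theta^K(c), for an interior
    letter [c] of a word of theta^(m+2)(b). The free [m] serves when blocks of level m have to be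
    split off. *)
Lemma legal_surround theta l m u :
  primitive theta -> (2 <= l)%N ->
  (forall b v, v \in theta b -> size v = l) -> legal theta u ->
  forall b, exists k w1 w2, [/\ (m <= k)%N, w1 ++ u ++ w2 \in subst_pow theta k b,
    (0 < size w1)%N & (0 < size w2)%N].
Proof.
move=> [[K [K0 Kprim]] _] l2 thl [k [a [v [k0 va /infixP[s1 [s2 vE]]]]]] b.
have /fset0Pn[x xb] := subst_pow_neq0 theta m.+2 b.
have := size_subst_pow thl xb.
(* Level [m.+2] gives at least four letters, so the second one, [c], has neighbours on both
   sides. *)
have : (2 ^ 2 <= l ^ m.+2)%N.
  by apply: leq_trans (_ : 2 ^ m.+2 <= _)%N; rewrite ?leq_exp2l ?leq_exp2r.
case: x xb => [|x1 [|c x2]] xb /=; try lia.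
move=> l4 szx.
have [y [yc ay]] := Kprim a c.
case/splitPr: ay yc => y1 y2 yc.
have [t1 [t2 [vt _ _]]] := subst_pow_surround va yc.
have [t3 [t4 [vt' t31 t42]]] := subst_pow_surround vt (xb : [:: x1] ++ c :: x2 \in _).
exists (k + K + m.+2)%N, (t3 ++ t1 ++ s1), (s2 ++ t2 ++ t4).
split; rewrite ?size_cat /=; try by move: t31 t42 => /=; lia.
by move: vt'; rewrite vE !catA.
Qed.

Lemma legal_extend theta l u :
  primitive theta -> (2 <= l)%N -> A ->
  (forall b v, v \in theta b -> size v = l) -> legal theta u ->
  exists c d, legal theta (c :: rcons u d).
Proof.
move=> thP l2 b thl uL.
have [k [w1 [w2 [k0 w]]]] := legal_surround 1 thP l2 thl uL b.
case/lastP: w1 w => [//|w1 c] w _; case: w2 w => [//|d w2] w _.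
exists c, d, k, b, (rcons w1 c ++ u ++ d :: w2); split=> //.
apply/infixP; exists w1, w2.
by rewrite cat_rcons -cats1 /= -!catA.
Qed.

(** Each step prepends one letter, so a letter once placed is kept and its index grows by one per
    step. *)
Lemma nth_iter_extend (f : seq A -> A * A) a u n t j :
  let U n := iter n (fun u => (f u).1 :: rcons u (f u).2) u in
  (j < size (U n))%N -> nth a (U (t + n)%N) (t + j) = nth a (U n) j.
Proof.
move=> U jn.
have szU m : size (U m) = (size u + m.*2)%N.
  by elim: m => [|m IHm]; rewrite ?addn0 //= size_rcons IHm; lia.
elim: t => [//|t IHt]; rewrite !addSn /= nth_rcons szU.
by rewrite szU in jn; case: ltnP; rewrite ?IHt //; lia.
Qed.

(** Iterating legal extensions by one letter on each side gives nested words that exhaust the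
    integers; their limit is the required point. *)
Lemma legal_in_subshift theta l u :
  primitive theta -> (2 <= l)%N -> A ->
  (forall b v, v \in theta b -> size v = l) -> legal theta u ->
  exists2 x, subshift theta x & window x 0 (size u) = u.
Proof.
move=> thP l2 a thl uL.
have /choice[f fL] : forall v, exists p : A * A,
    legal theta v -> legal theta (p.1 :: rcons v p.2).
  (* The pair [(a, a)] is a default value on words that are not legal. *)
  move=> v; have [vL|nvL] := pselect (legal theta v); last by exists (a, a).
  by have [c [d cd]] := legal_extend thP l2 a thl vL; exists (c, d).
pose U n := iter n (fun v => (f v).1 :: rcons v (f v).2) u.
have szU m : size (U m) = (size u + m.*2)%N.
  by elim: m => [|m IHm]; rewrite ?addn0 //= size_rcons IHm; lia.
have UL n : legal theta (U n) by elim: n => //= n; exact: fL.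
(* [x i] is read off the first word [U n] long enough on both sides to contain
   position [i]; the origin of [U n] is its letter of index [n]. *)
pose x (i : int) := nth a (U (absz i).+1) (absz (i + (absz i)%:Z + 1)%R).
have xE (i : int) n j : (j < size (U n))%N -> (i + n%:Z)%R = j -> x i = nth a (U n) j.
  move=> jn ij; rewrite /x.
  have j'n : (absz (i + (absz i)%:Z + 1)%R < size (U (absz i).+1))%N by rewrite szU; lia.
  (* Both letters are compared in stage n + |i| + 1, which extends the two words. *)
  rewrite -(nth_iter_extend a n j'n) -(nth_iter_extend a (absz i).+1 jn).
  by congr (nth _ (iter _ _ _) _); lia.
exists x => [i n|].
  (* [U N] covers the positions from -N to N - 1, hence the whole window. *)
  pose N := ((absz i) + n)%N.
  apply: legal_infix (UL N).
  suff -> : window x i n = take n (drop (absz (i + N%:Z)%R) (U N)).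
    by apply: infix_trans (infix_take _ _) (infix_drop _ _).
  have szw : size (take n (drop (absz (i + N%:Z)%R) (U N))) = n.
    by rewrite size_takel // size_drop szU /N; lia.
  apply: (@eq_from_nth _ a); first by rewrite size_mkseq szw.
  move=> j; rewrite size_mkseq => jn.
  rewrite nth_mkseq // nth_take // nth_drop.
  by apply: xE; rewrite ?szU /N; lia.
apply: (@eq_from_nth _ a); first by rewrite size_mkseq.
move=> j; rewrite size_mkseq => ju; rewrite nth_mkseq //.
by apply: (xE _ 0%N) => //; lia.
Qed.

End SubstitutionPowers.

(** * Factors of concatenations of blocks of equal length *)

Lemma size_flatten_const (T : eqType) (L : nat) (ss : seq (seq T)) :
  all (fun v => size v == L) ss -> size (flatten ss) = (size ss * L)%N.
Proof.
by elim: ss => //= v ss IHss /andP[/eqP vL /IHss ssL]; rewrite size_cat vL ssL.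
Qed.

Lemma drop_flatten_const (T : eqType) (L q : nat) (ss : seq (seq T)) :
  all (fun v => size v == L) ss -> drop (q * L) (flatten ss) = flatten (drop q ss).
Proof.
elim: q ss => [|q IHq] [|v ss] //=; first by rewrite drop0.
case/andP => /eqP vL ssL.
by rewrite mulSn addnC -drop_drop drop_size_cat // IHq.
Qed.

(* The list is padded with copies of [y] so that [r.+1] full blocks are
   available even when the factor ends with the last block. *)
Lemma take_drop_flatten (T : eqType) (L r s : nat) (ss : seq (seq T)) (y : seq T) :
  all (fun v => size v == L) (y :: ss) -> (0 < L)%N ->
  (s + r * L <= size (flatten ss))%N ->
  exists i bs, [/\ (i < L)%N, size bs = r.+1, {subset bs <= y :: ss} &
    take (r * L) (drop s (flatten ss)) = take (r * L) (drop i (flatten bs))].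
Proof.
move=> /= /andP[yL ssL] L0 srL.
pose xs := ss ++ nseq r.+1 y; pose ds := drop (s %/ L) xs.
have xsL : all (fun v => size v == L) xs by rewrite all_cat ssL all_nseq yL orbT.
have ssz := size_flatten_const ssL.
have qs : (s %/ L <= size ss)%N.
  by rewrite -(leq_pmul2r L0) -ssz; have := leq_divM s L; lia.
have rds : (r.+1 <= size ds)%N by rewrite size_drop size_cat size_nseq; lia.
have bsL : all (fun v => size v == L) (take r.+1 ds).
  by apply/allP => v /mem_take/mem_drop vxs; exact: (allP xsL).
have bsz : size (flatten (take r.+1 ds)) = (r.+1 * L)%N.
  by rewrite (size_flatten_const bsL) size_takel.
have iL : (s %% L < L)%N by rewrite ltn_mod.
exists (s %% L)%N, (take r.+1 ds); split => //; first by rewrite size_takel.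
  move=> v /mem_take/mem_drop; rewrite mem_cat => /orP[vss|]; first by rewrite inE vss orbT.
  by rewrite mem_nseq => /andP[_ /eqP->]; rewrite mem_head.
have -> : take (r * L) (drop s (flatten ss)) = take (r * L) (drop s (flatten xs)).
  rewrite flatten_cat drop_cat; case: ltnP => [slt|sge].
    by rewrite takel_cat // size_drop; lia.
  (* Here [s] is past the last letter, so the length bound leaves only [r * L = 0]. *)
  by rewrite (_ : r * L = 0)%N ?take0 //; lia.
(* Dropping [s %/ L] full blocks leaves an offset below [L], so the next [r.+1] blocks contain the
   factor. *)
rewrite {1}(divn_eq s L) addnC -drop_drop (drop_flatten_const _ xsL) -/ds.
rewrite -{1}(cat_take_drop r.+1 ds) flatten_cat drop_cat bsz.
rewrite ifT; last by rewrite mulSn; lia.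
by rewrite takel_cat // size_drop bsz mulSn; lia.
Qed.

(** * Counting legal words *)

Section Language.
Local Open Scope fset_scope.
Context {A : finType}.
Implicit Types (theta : random_substitution A) (u v w : seq A).

Definition language theta n : {fset seq A} :=
  [fset u in [seq tval w | w : n.-tuple A <- enum [set w : n.-tuple A | `[< legal theta w >]]%SET]].

Lemma languageP theta n u :
  reflect (size u = n /\ legal theta u) (u \in language theta n).
Proof.
rewrite inE; apply: (iffP mapP) => [[w + ->]|[sz uL]].
  by rewrite mem_enum inE => /asboolP wL; rewrite size_tuple.
have szu : size u == n by apply/eqP.
by exists (Tuple szu) => //; rewrite mem_enum inE; apply/asboolP.
Qed.

(** Words of points are legal by definition of the subshift; conversely [legal_in_subshift] finds
    each legal word in a point. *)
Lemma complexity_subshift theta l n :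
  primitive theta -> (2 <= l)%N -> A ->
  (forall b v, v \in theta b -> size v = l) ->
  complexity (subshift theta) n = #|` language theta n|.
Proof.
move=> thP l2 a thl.
rewrite /language card_fseq undup_id; last first.
  by rewrite map_inj_uniq ?enum_uniq //; exact: val_inj.
rewrite size_map -cardE; apply: eq_card => w; rewrite !inE.
apply/asboolP/asboolP => [[x [i [xX <-]]]|wL]; first exact: xX.
have [x xX xw] := legal_in_subshift thP l2 a thl wL.
by exists x, 0; split => //; rewrite -xw size_tuple.
Qed.

Lemma card_language_gt0 theta n : primitive theta -> (0 < #|` language theta n|)%N.
Proof.
move=> [_ [x xX]]; rewrite cardfs_gt0; apply/fset0Pn; exists (window x 0 n).
by apply/languageP; rewrite size_mkseq; split.
Qed.

(** Both pieces of a legal word cut after [n] letters are legal. Through the logarithm this is the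
    subadditivity fed into [fekete]. *)
Lemma card_language_add theta n m :
  (#|` language theta (n + m)| <= #|` language theta n| * #|` language theta m|)%N.
Proof.
apply: leq_trans (card_fset_cat_le _ _); apply: fsubset_leq_card.
apply/fsubsetP => u /languageP[szu uL]; apply/imfset2P.
exists (take n u) => /=.
  apply/languageP; split; first by rewrite size_takel // szu leq_addr.
  exact: legal_infix (infix_take _ _) uL.
exists (drop n u); last by rewrite cat_take_drop.
apply/languageP; split; first by rewrite size_drop szu addKn.
exact: legal_infix (infix_drop _ _) uL.
Qed.

Lemma card_subst_pow_le_language theta l m a :
  primitive theta -> (forall b v, v \in theta b -> size v = l) ->
  (#|` subst_pow theta m a| <= #|` language theta (l ^ m)|)%N.
Proof.
(* [legal] asks for a positive power, so level 0 is treated apart: its set is a singleton. *)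
move=> thP thl; case: m => [|m]; first by rewrite cardfs1 card_language_gt0.
apply: fsubset_leq_card; apply/fsubsetP => u ua.
apply/languageP; split; first exact: size_subst_pow thl ua.
by exists m.+1, a, u; split=> //; exact: infix_refl.
Qed.

(** Inflating the single word [v] already gives this many words, since all blocks have length l^m
    and can be read off their concatenation. *)
Lemma card_subst_powD theta l m k a v :
  (forall b w, w \in theta b -> size w = l) -> v \in subst_pow theta k a ->
  (\prod_(b <- v) #|` subst_pow theta m b| <= #|` subst_pow theta (m + k) a|)%N.
Proof.
move=> thl va.
rewrite -(@card_subst_word _ (rs_pow theta m) (l ^ m)); last first.
  by move=> b w; exact: size_subst_pow.
apply: fsubset_leq_card; apply/fsubsetP => w wv.
by apply/subst_powDP; exists v.
Qed.

(** A legal word of length r l^m is determined by an offset below l^m and a concatenation of r + 1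
    blocks, each an inflation word of level m of some letter. *)
Lemma card_language_blocks theta l m r :
  primitive theta -> (2 <= l)%N -> A ->
  (forall b v, v \in theta b -> size v = l) ->
  (#|` language theta (r * l ^ m)| <=
     l ^ m * (\sum_(b in A) #|` subst_pow theta m b|) ^ r.+1)%N.
Proof.
move=> thP l2 a thl; set L := (l ^ m)%N.
have L0 : (0 < L)%N by rewrite expn_gt0; lia.
pose B := \bigcup_(b <- enum A) subst_pow theta m b.
pose Bs n := iter n (fun S => [fset v ++ w | v in B, w in S]) [fset [::]].
have inB b v : v \in subst_pow theta m b -> v \in B.
  by move=> vb; apply/bigfcupP; exists b; rewrite ?mem_enum.
have BL v : v \in B -> size v == L.
  by case/bigfcupP => b _ vb; rewrite (size_subst_pow thl vb).
have inBs n (bs : seq (seq A)) :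
    size bs = n -> {subset bs <= B} -> flatten bs \in Bs n.
  elim: bs n => [|v bs IHbs] _ <- bsB; first by rewrite inE.
  apply/imfset2P; exists v; first by apply: bsB; rewrite mem_head.
  exists (flatten bs) => //; apply: IHbs => // w wbs.
  by apply: bsB; rewrite inE wbs orbT.
have cBs n : (#|` Bs n| <= #|` B| ^ n)%N.
  elim: n => [|n IHn]; first by rewrite cardfs1.
  by apply: leq_trans (card_fset_cat_le _ _) _; rewrite expnS leq_mul2l IHn orbT.
apply: (@leq_trans (L * #|` Bs r.+1|)%N); last first.
  rewrite leq_mul2l (leq_trans (cBs _)) ?orbT // leq_exp2r //.
  by rewrite (leq_trans (card_bigfcup_le _ _)) // big_enum.
rewrite -{2}(size_iota 0 L).
rewrite -(size_allpairs (fun i w => take (r * L) (drop i w))).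
apply: uniq_leq_size (fset_uniq _) _ => u /languageP[szu uL].
have [k [w1 [w2 [mk w12 _ _]]]] := legal_surround m thP l2 thl uL a.
move: w12; rewrite -(subnKC mk) => /subst_powDP[x _].
case/subst_word_flatten => ss xss wE.
(* The block [y] is only there for the padding in [take_drop_flatten]. *)
have [y /inB yB] := fset0Pn _ (subst_pow_neq0 theta m a).
have ssB : {subset y :: ss <= B}.
  move=> v; rewrite inE => /orP[/eqP->//|/xss[b]].
  exact: inB.
have [||i [bs [iL bsr bsy uE]]] := @take_drop_flatten _ L r (size w1) ss y _ L0.
- by apply/allP => v /ssB/BL.
- by rewrite -wE !size_cat szu leq_add2l leq_addr.
apply/allpairsP; exists (i, flatten bs); split => [||/=].
- by rewrite mem_iota.
- by apply: (inBs r.+1) => // v /bsy/ssB.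
- by rewrite -uE -wE drop_size_cat // take_size_cat.
Qed.

End Language.

(** * Real sequences: Fekete's lemma and contraction of a gap *)

Section RealSequences.
Local Open Scope ring_scope.
Context {R : realType}.

Lemma nat_multiple_ge (d c : R) : 0 < d ->
  exists N : nat, (0 < N)%N /\ forall n, (N <= n)%N -> c <= n%:R * d.
Proof.
move=> d0; exists (Num.truncn (`|c| / d)).+1; split => // n Nn.
rewrite -ler_pdivrMr //; apply: le_trans (_ : `|c| / d <= _).
  by rewrite ler_pM2r ?invr_gt0 // ler_norm.
by apply/ltW; apply: lt_le_trans (truncnS_gt _) _; rewrite ler_nat.
Qed.

(** The limit is the infimum of u(n)/n over n > 0: Euclidean division by a nearly optimal index
    bounds u(n)/n from above, up to a remainder. *)
Lemma fekete (u : nat -> R) :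
  (forall n, 0 <= u n) -> (forall n m, u (n + m)%N <= u n + u m) ->
  exists h, [/\ 0 <= h, forall n, n%:R * h <= u n &
    (fun n => n%:R^-1 * u n) @ \oo --> h].
Proof.
move=> u0 uD; pose E := [set n.+1%:R^-1 * u n.+1 | n in [set: nat]].
have E0 : lbound E 0 by move=> _ [n _ <-]; rewrite mulr_ge0.
have En0 : E !=set0 by exists (1%:R^-1 * u 1%N); exists 0%N.
have hu n : n%:R * inf E <= u n.
  case: n => [|n]; first by rewrite mul0r.
  rewrite mulrC -ler_pdivlMr // mulrC.
  by apply: ge_inf; [exists 0|exists n].
exists (inf E); split => //; first exact: lb_le_inf.
apply/cvgrPdist_le => e e0.
have e20 : 0 < e / 2 by lra.
have [_ [k _ <-] ke] := inf_adherent e20 (conj En0 (ex_intro _ 0 E0)).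
(* [C] bounds [u] at every remainder modulo [k.+1]; from [N] on it is at most n e/2. *)
pose C := \sum_(s < k.+1) u s.
have [N [N0 NC]] := nat_multiple_ge C e20.
exists N => // n Nn /=.
have n0 : (0 : R) < n%:R by rewrite ltr0n; exact: leq_trans Nn.
rewrite distrC ger0_norm; last first.
  by rewrite subr_ge0 mulrC ler_pdivlMr // mulrC.
rewrite lerBlDl mulrC ler_pdivrMr //.
have uMq q : u (q * k.+1 + n %% k.+1)%N <= q%:R * u k.+1 + u (n %% k.+1)%N.
  elim: q => [|q IHq]; first by rewrite mul0r add0r.
  rewrite mulSn -addnA; apply: le_trans (uD _ _) _.
  by rewrite -natr1; lra.
have := uMq (n %/ k.+1)%N; rewrite -divn_eq => {uMq}/le_trans; apply.
have uC : u (n %% k.+1)%N <= C.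
  have nk : (n %% k.+1 < k.+1)%N by rewrite ltn_mod.
  by rewrite /C (bigD1 (Ordinal nk)) //= lerDl sumr_ge0.
have uk : u k.+1 <= k.+1%:R * (inf E + e / 2).
  by rewrite -ler_pdivrMl // ltW.
(* This sign permits replacing [n %/ k.+1 * k.+1] by the larger [n]. *)
have he : 0 <= inf E + e / 2 by rewrite addr_ge0 ?(ltW e20) //; exact: lb_le_inf.
have : (n %/ k.+1)%:R * u k.+1 <= n%:R * (inf E + e / 2).
  apply: le_trans (ler_wpM2l (ler0n _ _) uk) _.
  by rewrite mulrA -natrM ler_wpM2r // ler_nat leq_divM.
have := NC _ Nn; lra.
Qed.

(* A fraction [q] of the gap below [h] is closed every [K] steps. *)
Lemma gap_contraction_cvg (I : Type) (L : nat -> I -> R) (up lo : nat -> R)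
    (h q : R) (K : nat) :
  0 < q <= 1 -> (forall m i, 0 <= L m i) -> (forall m i, L m i <= up m) ->
  up @ \oo --> h -> lo @ \oo --> h ->
  (forall m, exists i, lo m <= L m i) ->
  (forall m i j c, (forall i', c <= L m i') ->
     (1 - q) * c + q * L m j <= L (m + K)%N i) ->
  forall i, L^~ i @ \oo --> h.
Proof.
move=> /andP[q0 q1] L0 Lup uph loh Llo LK i.
apply/cvgrPdist_le => e e0.
have e20 : 0 < e / 2 by lra.
have /cvgrPdist_le/(_ _ e0)[N1 _ HN1] := uph.
have /cvgrPdist_le/(_ _ e20)[N2 _ HN2] := loh.
(* Since [L] is non-negative, the initial gap is at most |h|; each round of [K] steps multiplies it
   by 1 - q, while e/2 absorbs the error of [lo]. *)
have gap t m j : (N2 + t * K <= m)%N -> h - e / 2 - (1 - q) ^+ t * `|h| <= L m j.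
  elim: t m j => [|t IHt] m j tm.
    by rewrite expr0 mul1r; have := L0 m j; have := ler_norm h; lra.
  have Km : (K <= m)%N by lia.
  have [j' loj'] := Llo (m - K)%N.
  rewrite -(subnK Km); apply: le_trans (LK (m - K)%N j j' _ (fun i' => IHt _ i' _)); last by lia.
  have : h - e / 2 <= L (m - K)%N j'.
    have /= := HN2 (m - K)%N; have mN2 : (N2 <= m - K)%N by lia.
    by move=> /(_ mN2); have := ler_norm (h - lo (m - K)%N); lra.
  rewrite -(ler_pM2l q0) exprS; lra.
have [t te] : exists t, (1 - q) ^+ t * `|h| <= e / 2.
  have q1n : `|1 - q| < 1 by rewrite ger0_norm; lra.
  (* Dividing by |h| + 1 instead of |h| allows h = 0. *)
  have h10 : 0 < e / 2 / (`|h| + 1) by rewrite divr_gt0 // ltr_wpDl.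
  have /cvgrPdist_le/(_ _ h10)[t _ /(_ t (leqnn t))/=] := cvg_expr q1n.
  rewrite sub0r normrN ger0_norm ?exprn_ge0 ?subr_ge0 // => te; exists t.
  rewrite ler_pdivlMr ?ltr_wpDl // in te; apply: le_trans te.
  by rewrite ler_wpM2l ?exprn_ge0 ?subr_ge0 // lerDl.
exists (maxn N1 (N2 + t * K)) => // m /= mN.
have /HN1/= : (N1 <= m)%N by lia.
rewrite !ler_norml => /andP[hup _].
have := Lup m i; have /gap-/(_ i) : (N2 + t * K <= m)%N by lia.
by move=> *; apply/andP; split; lra.
Qed.

End RealSequences.

(** * Comparison of the two entropies *)

Section Entropy.
Local Open Scope ring_scope.
Context {R : realType} {A : finType}.
Implicit Types (theta : random_substitution A).

Lemma ln_prod_nat (I : Type) (s : seq I) (F : I -> nat) :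
  (forall i, (0 < F i)%N) ->
  ln (\prod_(i <- s) F i)%N%:R = \sum_(i <- s) ln (F i)%:R :> R.
Proof.
move=> F0; elim: s => [|i s IHs]; first by rewrite !big_nil ln1.
by rewrite !big_cons natrM lnM ?IHs // posrE ltr0n ?prodn_gt0.
Qed.

Lemma ler_ln_nat (n m : nat) :
  (0 < n)%N -> (n <= m)%N -> ln n%:R <= ln m%:R :> R.
Proof.
by move=> n0 nm; rewrite ler_ln ?ler_nat // posrE ltr0n //; exact: leq_trans nm.
Qed.

Lemma ln_nat_ge0 (n : nat) : 0 <= ln n%:R :> R.
Proof. by case: n => [|n]; [rewrite ln0|rewrite ln_ge0 // ler1n]. Qed.

Lemma cvg_expn (l : nat) : (2 <= l)%N -> (fun m => l ^ m)%N @ \oo --> \oo.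
Proof.
move=> l2; apply/cvgnyPge => n; exists n => // m /= nm.
by apply: leq_trans nm _; apply: ltnW; exact: ltn_expl.
Qed.

Lemma subst_pow_card_gt0 theta m a : (0 < #|` subst_pow theta m a|)%N.
Proof. by rewrite cardfs_gt0 subst_pow_neq0. Qed.

(* In [card_language_blocks] with [r] blocks, the choice of the offset and the
   extra block have negligible cost as [r] tends to infinity. *)
Lemma entropy_max_ge theta (l : nat) (h : R) m :
  primitive theta -> (2 <= l)%N -> A ->
  (forall b v, v \in theta b -> size v = l) ->
  (forall n, n%:R * h <= ln (#|` language theta n|)%:R) ->
  exists b, (l ^ m)%:R * h <= ln #|A|%:R + ln (#|` subst_pow theta m b|)%:R.
Proof.
move=> thP l2 a thl hp.
pose b := [arg max_(i > a) #|` subst_pow theta m i| ]%N.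
have bmax i : (#|` subst_pow theta m i| <= #|` subst_pow theta m b|)%N.
  by rewrite /b; case: arg_maxnP => // j _; apply.
exists b; rewrite leNgt; apply/negP => ltxy.
set x := _ * h in ltxy; set y := _ + _ in ltxy.
have xy0 : 0 < x - y by rewrite subr_gt0.
have l0 : (0 < l ^ m)%N by rewrite expn_gt0; lia.
have A0 : (0 < #|A|)%N by apply/card_gt0P; exists a.
(* With this [r], r (x - y) strictly exceeds ln(l^m) + y, contradicting the block count; the 1 gives
   strictness. *)
have [r [_ /(_ _ (leqnn r))]] := nat_multiple_ge (ln (l ^ m)%:R + y + 1) xy0.
suff : r%:R * x <= ln (l ^ m)%:R + r.+1%:R * y by rewrite -natr1; lra.
rewrite mulrA -natrM; apply: le_trans (hp _) _.
have -> : ln (l ^ m)%:R + r.+1%:R * y =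
    ln (l ^ m * (#|A| * #|` subst_pow theta m b|) ^ r.+1)%N%:R.
  rewrite /y -lnM ?posrE ?ltr0n ?subst_pow_card_gt0 //.
  rewrite mulr_natl -lnXn -?natrM ?ltr0n ?muln_gt0 ?subst_pow_card_gt0 ?A0 //.
  by rewrite -natrX -lnM -?natrM // posrE ltr0n // expn_gt0 muln_gt0 subst_pow_card_gt0 A0.
apply: ler_ln_nat; first exact: card_language_gt0.
apply: leq_trans (card_language_blocks _ _ thP l2 a thl) _.
rewrite leq_mul2l leq_exp2r // -sum_nat_const leq_sum ?orbT // => i _; exact: bmax.
Qed.

(** By [card_subst_powD], the value at [i] is at least the average of the level-m values over the
    l^K letters of [v]; one of them is [j] and the others contribute at least [c] each. *)
Lemma entropy_seq_step theta (l : nat) m K i j (c : R) v :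
  (2 <= l)%N -> (forall b v, v \in theta b -> size v = l) ->
  v \in subst_pow theta K i -> j \in v ->
  (forall b, c <= inflation_entropy_seq R theta b m) ->
  (1 - (l ^ K)%:R^-1) * c + (l ^ K)%:R^-1 * inflation_entropy_seq R theta j m <=
    inflation_entropy_seq R theta i (m + K).
Proof.
move=> l2 thl vi jv cL.
have lX n : 0 < (l ^ n)%:R :> R by rewrite ltr0n expn_gt0; lia.
pose L b : R := (l ^ m)%:R^-1 * ln (#|` subst_pow theta m b|)%:R.
have LE b n : inflation_entropy_seq R theta b n =
    (l ^ n)%:R^-1 * ln (#|` subst_pow theta n b|)%:R.
  by rewrite /inflation_entropy_seq (inflation_lengthE n b thl).2.
have {}cL b : c <= L b by rewrite /L -LE.
rewrite !LE -/(L j).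
have sumL : c * ((l ^ K)%:R - 1) + L j <= \sum_(b <- v) L b.
  rewrite -(size_subst_pow thl vi); case/splitPr: jv => v1 v2.
  have sumge s : (size s)%:R * c <= \sum_(b <- s) L b.
    elim: s => [|b s IHs]; first by rewrite big_nil mul0r.
    by rewrite big_cons -natr1; have := cL b; lra.
  rewrite big_cat big_cons size_cat /= natrD -natr1.
  by have := sumge v1; have := sumge v2; lra.
apply: (@le_trans _ _ ((l ^ K)%:R^-1 * \sum_(b <- v) L b)).
  have -> : (1 - (l ^ K)%:R^-1) * c = (l ^ K)%:R^-1 * (c * ((l ^ K)%:R - 1)).
    by field; exact: lt0r_neq0.
  by rewrite -mulrDr ler_pM2l // invr_gt0.
rewrite -mulr_sumr -ln_prod_nat; last by move=> b; exact: subst_pow_card_gt0.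
rewrite mulrA -invfM -natrM -expnD addnC ler_pM2l ?invr_gt0 //.
apply: ler_ln_nat; last exact: (card_subst_powD m thl vi).
by rewrite prodn_gt0 // => b; exact: subst_pow_card_gt0.
Qed.

Lemma inflation_entropy_cvg theta (l : nat) (a : A) :
  primitive theta -> (2 <= l)%N ->
  (forall b v, v \in theta b -> size v = l) ->
  exists h : R, inflation_entropy_seq R theta a @ \oo --> h /\
    (fun n => n%:R^-1 * ln (complexity (subshift theta) n)%:R) @ \oo --> h.
Proof.
move=> thP l2 thl.
pose u n : R := ln (#|` language theta n|)%:R.
have uD n m : u (n + m)%N <= u n + u m.
  rewrite -lnM ?posrE ?ltr0n ?card_language_gt0 // -natrM.
  by apply: ler_ln_nat (card_language_add _ _ _); exact: card_language_gt0.
have [h [h0 hu uh]] := fekete (fun n => ln_nat_ge0 _) uD.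
exists h; split; last first.
  by under eq_fun do rewrite (complexity_subshift _ thP l2 a thl).
have [[K [K0 Kprim]] _] := thP.
have lX n : 0 < (l ^ n)%:R :> R by rewrite ltr0n expn_gt0; lia.
have LE m b : inflation_entropy_seq R theta b m =
    (l ^ m)%:R^-1 * ln (#|` subst_pow theta m b|)%:R.
  by rewrite /inflation_entropy_seq (inflation_lengthE m b thl).2.
(* The upper bound is Fekete's sequence along the lengths l^m, the lower one comes from
   [entropy_max_ge]. *)
apply: (@gap_contraction_cvg _ _ (fun m b => inflation_entropy_seq R theta b m)
  (fun m => (l ^ m)%:R^-1 * u (l ^ m)%N)
  (fun m => h - (l ^ m)%:R^-1 * ln #|A|%:R) h (l ^ K)%:R^-1 K _ _ _ _ _ _ _ a).
- rewrite invr_gt0 lX /= invf_le1 // ler1n expn_gt0; lia.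
- by move=> m b; rewrite LE mulr_ge0 ?invr_ge0 ?ln_nat_ge0.
- move=> m b; rewrite LE ler_pM2l ?invr_gt0 //.
  apply: ler_ln_nat; first exact: subst_pow_card_gt0.
  exact: card_subst_pow_le_language.
- exact: (cvg_comp _ _ (cvg_expn l2) uh).
- rewrite -[X in _ --> X]subr0 -(mul0r (ln #|A|%:R)).
  apply: cvgB; first exact: cvg_cst.
  apply: cvgM (cvg_cst _).
  apply/gtr0_cvgV0; first exact: nearW.
  exact/cvgrnyP/cvg_expn.
- move=> m; have [b hb] := entropy_max_ge m thP l2 a thl hu.
  exists b; rewrite LE lerBlDl -mulrDr mulrC ler_pdivlMr // mulrC.
  exact: hb.
- move=> m i j c cL; have [v [vi jv]] := Kprim j i.
  exact: entropy_seq_step vi jv cL.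
Qed.

End Entropy.

Theorem theorem4p1 (R : realType) (A : finType)
    (theta : random_substitution A)
    (theta_prim : primitive theta) (theta_len : constant_length theta)
    (a : A) :
  cvgn (inflation_entropy_seq R theta a) /\
  inflation_entropy R theta a = topological_entropy R (subshift theta).
Proof.
have [l [l2 thl]] := theta_len.
have [h [ah Xh]] := inflation_entropy_cvg (R := R) a theta_prim l2 thl.
split; first by apply/cvg_ex; exists h.
by rewrite /inflation_entropy /topological_entropy (cvg_lim _ ah) // (cvg_lim _ Xh).
Qed.
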